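(* Let $x_0 \in \mathcal D_N$, and let $\{x_k\}_{k\ge 0}$ be the trajectory of the closed-loop system $x_{k+1}=f(x_k,u_k)$, $u_k=u^*_{k|k}$, starting at $x_0$. Then: (i) the finite horizon optimal control problem $(\mathrm{OCP})$ at state $x_k$ is feasible for all $k \in \mathbb Z_+$; and (ii) $x_e \in M$ is an asymptotically stable equilibrium of the closed-loop system with basin of attraction $\mathcal D_N$, i.e., for any $x_0 \in \mathcal D_N$ and $\varepsilon > 0$ there exists $\delta > 0$ such that $d(x_0,x_e) < \delta$ implies $d(x_k,x_e) < \varepsilon$ for all $k > 0$, and furthermore $d(x_k,x_e) \rightarrow 0$ as $k \rightarrow \infty$.
   Context: Notation: $\mathbb Z_N=\{0,1,\dots,N-1\}$ and $\mathbb Z_+$ is the set of nonnegative integers. A function $\alpha:[0,a)\to[0,\infty)$ is class $\mathcal K$ if it is strictly increasing and $\alpha(0)=0$; it is class $\mathcal K_\infty$ if moreover $a=\infty$ and $\alpha(x)\to\infty$ as $x\to\infty$. Dynamics and constraints: $M$ is an $n$-dimensional smooth manifold endowed with a metric $d$ (inducing its topology) and $U$ is a compact subset of an $m$-dimensional smooth manifold. The map $f:M\times U\to M$ is continuously differentiable and $f(x_e,u_e)=x_e$ for some $x_e\in M$, $u_e\in U$. The dynamics are $x_{k+1}=f(x_k,u_k)$. The constraint sets $\mathcal X\subset M$ and $\mathcal U\subset U$ are compact and connected, with $x_e\in\operatorname{int}\mathcal X$ and $u_e\in\operatorname{int}\mathcal U$. Costs: $L:M\times U\to\mathbb R$ and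 $F:M\to\mathbb R$ are twice continuously differentiable, with $L(x_e,u_e)=F(x_e)=0$, and for all $x\in M$, $u\in U$: $L(x,u)\ge L(x,u_e)\ge\gamma(d(x,x_e))$ and $F(x)\ge\alpha(d(x,x_e))$, where $\gamma$ is class $\mathcal K_\infty$ and $\alpha$ is class $\mathcal K$. Target set and local control law: $\mathcal X_T\subset\mathcal X$ is compact with $x_e\in\operatorname{int}\mathcal X_T$, and $\kappa:M\to U$ satisfies, for all $x\in\mathcal X_T$: $\kappa(x)\in\mathcal U$; $f(x,\kappa(x))\in\mathcal X_T$; and $F(f(x,\kappa(x)))-F(x)\le -L(x,\kappa(x))$. Finite horizon optimal control problem $(\mathrm{OCP})$ at state $x_k$, with horizon $N$: minimize over $\{u_{k+i|k}\}_{i\in\mathbb Z_N}$ the cost $$\mathcal V_N(x_k;\{u_{k+i|k}\}_{i\in\mathbb Z_N})=F(x_{k+N|k})+\sum_{i\in\mathbb Z_N}L(x_{k+i|k},u_{k+i|k})$$ subject to $x_{k|k}=x_k$ and, for all $i\in\mathbb Z_N$, $x_{k+i+1|k}=f(x_{k+i|k},u_{k+i|k})$, $x_{k+i|k}\in\mathcal X$, $u_{k+i|k}\in\mathcal U$, and the terminal constraint $x_{k+N|k}\in\mathcal X_T$. A minimizing sequence is denoted $\{u^*_{k+i|k}\}_{i\in\mathbb Z_N}$, and the MPC law applies its first element, $u_k=u^*_{k|k}$. The set $\mathcal D_N$ is the set of all $x_k\in M$ for which there exists a sequence $\{u_{k+i|k}\}_{i\in\mathbb Z_N}$ satisfying all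 the constraints of $(\mathrm{OCP})$. *)

(* Defs.v *)
From HB Require Import structures.
From mathcomp Require Import all_boot all_order all_algebra.
From mathcomp Require Import all_classical all_reals all_analysis.
Set Implicit Arguments.
Unset Strict Implicit.
Unset Printing Implicit Defensive.
Import Order.TTheory GRing.Theory Num.Theory.
Import numFieldNormedType.Exports.
Local Open Scope classical_set_scope.
Local Open Scope ring_scope.

(* [A] is meant to be open. The directional derivatives along all vectors
   are the (linear combinations of the) partial derivatives. *)
Fixpoint Ck_on (R : realType) (n p k : nat) (A : set 'rV[R]_n)
    (g : 'rV[R]_n -> 'rV[R]_p) : Prop :=
  if k is k'.+1 then
    (forall x, A x -> differentiable g x) /\ forall v, Ck_on k' A ('D_v g)
  else forall x, A x -> {for x, continuous g}.

(* The values of [cmap] outside [cdom], and of [cinv] outside the image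
   [cmap @` cdom], are irrelevant. *)
Record chart (R : realType) (n : nat) (T : Type) := Chart {
  cdom : set T;
  cmap : T -> 'rV[R]_n;
  cinv : 'rV[R]_n -> T }.

Definition is_chart (R : realType) (n : nat) (T : topologicalType)
    (c : chart R n T) : Prop :=
  [/\ open (cdom c), open (cmap c @` cdom c),
      forall x, cdom c x -> cinv c (cmap c x) = x,
      {within cdom c, continuous (cmap c)} &
      {within cmap c @` cdom c, continuous (cinv c)}].

(* The atlas [A] need not be maximal. *)
Definition smooth_manifold (R : realType) (n : nat) (T : topologicalType)
    (A : set (chart R n T)) : Prop :=
  [/\ hausdorff_space T,
      @second_countable T,
      forall c, A c -> is_chart c,
      forall x : T, exists2 c, A c & cdom c x &
      forall c c', A c -> A c' -> forall k,
        Ck_on k (cmap c @` (cdom c `&` cdom c')) (cmap c' \o cinv c)].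

Definition prod_chart (R : realType) (n m : nat) (T T' : Type)
    (c : chart R n T) (c' : chart R m T') : chart R (n + m) (T * T') :=
  Chart (cdom c `*` cdom c')
    (fun z => row_mx (cmap c z.1) (cmap c' z.2))
    (fun w => (cinv c (lsubmx w), cinv c' (rsubmx w))).

Definition prod_atlas (R : realType) (n m : nat) (T T' : Type)
    (A : set (chart R n T)) (A' : set (chart R m T')) :
    set (chart R (n + m) (T * T')) :=
  [set e | exists c c', [/\ A c, A' c' & e = prod_chart c c']].

Definition line_atlas (R : realType) : set (chart R 1 R) :=
  [set Chart setT (fun r => const_mx r) (fun w : 'rV[R]_1 => w ord0 ord0)].

(* [f] is of class C^k on the arbitrary subset [S]: around every point of [S]
   it agrees, on [S], with a map [g] that is C^k in charts on an open
   neighbourhood [W]. For open [S] this says that [f] itself is C^k on [S].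
   The values of [f] outside [S] do not matter. *)
Definition Ck_map (R : realType) (n p : nat) (T T' : topologicalType) (k : nat)
    (A : set (chart R n T)) (A' : set (chart R p T'))
    (S : set T) (f : T -> T') : Prop :=
  forall x, S x ->
    exists (c : chart R n T) (c' : chart R p T') (W : set T) (g : T -> T'),
      [/\ A c, A' c', open W, W x & W `<=` cdom c] /\
      [/\ forall y, W y -> cdom c' (g y),
          forall y, W y -> S y -> g y = f y &
          Ck_on k (cmap c @` W) (cmap c' \o g \o cinv c)].

(* The domain of [alpha] is [0, a[. *)
Definition class_K (R : realType) (a : \bar R) (alpha : R -> R) : Prop :=
  [/\ (0 < a)%E, alpha 0 = 0,
      forall r, 0 <= r -> (r%:E < a)%E -> 0 <= alpha r &
      forall r s, 0 <= r -> r < s -> (s%:E < a)%E -> alpha r < alpha s].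

Definition class_Kinfty (R : realType) (alpha : R -> R) : Prop :=
  class_K +oo%E alpha /\ alpha r @[r --> +oo] --> +oo.

(* A control sequence indexed by {0, .., N-1} is encoded by a function on
   [nat]: no definition below, for horizon [N], reads [v i] for [N <= i]. *)
Fixpoint predicted (M P : Type) (f : M * P -> M) (x : M) (v : nat -> P)
    (i : nat) : M :=
  if i is j.+1 then f (predicted f x v j, v j) else x.

Definition ocp_cost (R : realType) (M P : Type) (f : M * P -> M)
    (L : M * P -> R) (F : M -> R) (N : nat) (x : M) (v : nat -> P) : R :=
  F (predicted f x v N) + \sum_(i < N) L (predicted f x v i, v i).

Definition ocp_admissible (M P : Type) (f : M * P -> M) (X : set M)
    (Uc : set P) (XT : set M) (N : nat) (x : M) (v : nat -> P) : Prop :=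
  (forall i, (i < N)%N -> X (predicted f x v i) /\ Uc (v i)) /\
  XT (predicted f x v N).

Definition feasible_set (M P : Type) (f : M * P -> M) (X : set M)
    (Uc : set P) (XT : set M) (N : nat) : set M :=
  [set x | exists v, ocp_admissible f X Uc XT N x v].

Definition ocp_minimizer (R : realType) (M P : Type) (f : M * P -> M)
    (L : M * P -> R) (F : M -> R) (X : set M) (Uc : set P) (XT : set M)
    (N : nat) (x : M) (v : nat -> P) : Prop :=
  ocp_admissible f X Uc XT N x v /\
  forall w, ocp_admissible f X Uc XT N x w ->
    ocp_cost f L F N x v <= ocp_cost f L F N x w.

(* The input at time [k] is the first element of a minimizer of the problem
   at [x k], whenever one exists. Neither feasibility nor existence of
   minimizers along the trajectory is assumed: where there is no minimizer,
   the input is an arbitrary element of [U]. *)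
Definition closed_loop (R : realType) (M P : Type) (U : set P)
    (f : M * P -> M) (L : M * P -> R) (F : M -> R) (X : set M) (Uc : set P)
    (XT : set M) (N : nat) : set (nat -> M) :=
  [set x | exists u : nat -> P, forall k,
    [/\ U (u k), x k.+1 = f (x k, u k) &
        (exists v, ocp_minimizer f L F X Uc XT N (x k) v) ->
        exists2 v, ocp_minimizer f L F X Uc XT N (x k) v & u k = v 0%N]].

(* [S] is the set of trajectories of the system and [D] the basin of
   attraction; delta does not depend on the trajectory. *)
Definition asymptotically_stable (R : realType) (M : metricType R)
    (S : set (nat -> M)) (xe : M) (D : set M) : Prop :=
  [/\ forall x, S x -> x 0%N = xe -> forall k, x k = xe,
      forall eps : R, 0 < eps -> exists2 delta : R, 0 < delta &
        forall x, S x -> D (x 0%N) -> mdist (x 0%N) xe < delta ->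
          forall k, (0 < k)%N -> mdist (x k) xe < eps &
      forall x, S x -> D (x 0%N) -> mdist (x k) xe @[k --> \oo] --> (0 : R)].

(* Main.v *)
(* Appending the local control law to the tail of a minimizing sequence gives an
   admissible sequence at the successor state, hence recursive feasibility, and
   shows that the optimal cost V decreases by at least L(x_k, u_k) >=
   gamma(d(x_k, x_e)) at each step. Since V >= 0, these decrements tend to 0,
   which gives attraction. Using the local control law alone yields V <= F on
   X_T, so gamma(d(x_k, x_e)) <= V(x_k) <= V(x_0) <= F(x_0), which gives
   stability because F is continuous at x_e. Minimizers exist because the
   admissible sequences form a compact set in the product topology. *)
Require Import Defs.
From HB Require Import structures.
From mathcomp Require Import all_boot all_order all_algebra.
From mathcomp Require Import all_classical all_reals all_analysis.
From mathcomp Require Import lra.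
Set Implicit Arguments.
Unset Strict Implicit.
Import Order.TTheory GRing.Theory Num.Theory.
Import numFieldNormedType.Exports.
Local Open Scope classical_set_scope.
Local Open Scope ring_scope.

(** * Charts, products of charts, and continuity of maps that are smooth in charts *)

Lemma cvg_rV (R : realType) (n : nat) (T : Type) (D : set_system T)
    (g : T -> 'rV[R]_n) (l : 'rV[R]_n) : Filter D ->
  (forall j, g y ord0 j @[y --> D] --> l ord0 j) -> g @ D --> l.
Proof.
move=> FD gl B [Q QB sB].
suff : \forall y \near D, forall j, Q ord0 j (g y ord0 j).
  by apply: filterS => y yQ; apply: sB => i j; rewrite ord1.
by apply: filter_forall => j; apply: gl; exact: QB.
Qed.

Lemma row_mx_continuous (R : realType) (n m : nat) (T : topologicalType)
    (g : T -> 'rV[R]_n) (h : T -> 'rV[R]_m) (z : T) :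
  {for z, continuous g} -> {for z, continuous h} ->
  {for z, continuous (fun y => row_mx (g y) (h y))}.
Proof.
move=> gz hz; apply: cvg_rV => j.
case: (split_ordP j) => k ->.
  under eq_fun do rewrite row_mxEl; rewrite row_mxEl.
  exact: cvg_comp gz (@coord_continuous R 1 n ord0 k (g z)).
under eq_fun do rewrite row_mxEr; rewrite row_mxEr.
exact: cvg_comp hz (@coord_continuous R 1 m ord0 k (h z)).
Qed.

Lemma lsubmx_continuous (R : realType) (n m : nat) :
  continuous (@lsubmx R 1 n m).
Proof.
move=> w; apply: (@cvg_rV _ _ _ (nbhs w)) => j; under eq_fun do rewrite mxE; rewrite mxE.
exact: coord_continuous.
Qed.

Lemma rsubmx_continuous (R : realType) (n m : nat) :
  continuous (@rsubmx R 1 n m).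
Proof.
move=> w; apply: (@cvg_rV _ _ _ (nbhs w)) => j; under eq_fun do rewrite mxE; rewrite mxE.
exact: coord_continuous.
Qed.

Lemma cmap_continuous (R : realType) (n : nat) (T : topologicalType)
    (c : chart R n T) (z : T) :
  is_chart c -> cdom c z -> {for z, continuous (cmap c)}.
Proof.
move=> [oD _ _ cc _] zc; move: cc; rewrite continuous_open_subspace//.
by move=> /(_ z); apply; rewrite inE.
Qed.

Lemma cinv_continuous (R : realType) (n : nat) (T : topologicalType)
    (c : chart R n T) (w : 'rV[R]_n) :
  is_chart c -> (cmap c @` cdom c) w -> {for w, continuous (cinv c)}.
Proof.
move=> [_ oI _ _ ci] wI; move: ci; rewrite continuous_open_subspace//.
by move=> /(_ w); apply; rewrite inE.
Qed.

Lemma is_chart_prod (R : realType) (n m : nat) (T T' : topologicalType)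
    (c : chart R n T) (c' : chart R m T') :
  is_chart c -> is_chart c' -> is_chart (prod_chart c c').
Proof.
move=> hc hc'; have [oD oI cK _ _] := hc; have [oD' oI' cK' _ _] := hc'.
(* The image of the product chart is an intersection of preimages under the two block projections.
   This makes it open and locates the points where both inverse charts are continuous. *)
have imE : cmap (prod_chart c c') @` cdom (prod_chart c c') =
    (@lsubmx R 1 n m @^-1` (cmap c @` cdom c)) `&`
    (@rsubmx R 1 n m @^-1` (cmap c' @` cdom c')).
  apply/seteqP; split=> [_ [[x y] [/= xD yD] <-]|w [[x xD xw] [y yD yw]]] /=.
    by split; rewrite /= ?row_mxKl ?row_mxKr; [exists x|exists y].
  by exists (x, y) => //=; rewrite xw yw hsubmxK.
have oDD : open (cdom (prod_chart c c')).
  rewrite openE => -[x y] [/= xD yD]; exists (cdom c, cdom c') => //.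
  by split; exact: open_nbhs_nbhs.
have oII : open (cmap (prod_chart c c') @` cdom (prod_chart c c')).
  rewrite imE; apply: openI; apply: open_comp => // w _.
    exact: lsubmx_continuous.
  exact: rsubmx_continuous.
split=> //.
- by move=> [x y] [/= xD yD]; rewrite row_mxKl row_mxKr cK// cK'.
- rewrite continuous_open_subspace// => -[x y]; rewrite inE => -[/= xD yD].
  apply: (@row_mx_continuous _ _ _ _ (cmap c \o fst) (cmap c' \o snd) (x, y)).
    by apply: cvg_comp; [exact: cvg_fst|exact: cmap_continuous].
  by apply: cvg_comp; [exact: cvg_snd|exact: cmap_continuous].
- rewrite continuous_open_subspace// => w; rewrite inE imE => -[/= wl wr].
  apply: (@cvg_pair _ _ _ (nbhs w) _ _ _ _ _ (cinv c \o lsubmx) (cinv c' \o rsubmx)).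
    exact: cvg_comp (@lsubmx_continuous R n m w) (cinv_continuous hc wl).
  exact: cvg_comp (@rsubmx_continuous R n m w) (cinv_continuous hc' wr).
Qed.

Lemma is_chart_prod_atlas (R : realType) (n m : nat) (T T' : topologicalType)
    (A : set (chart R n T)) (A' : set (chart R m T')) :
  A `<=` @is_chart R n T -> A' `<=` @is_chart R m T' ->
  prod_atlas A A' `<=` @is_chart R (n + m) (T * T')%type.
Proof. by move=> hA hA' _ [c [c' [Ac A'c' ->]]]; apply: is_chart_prod; auto. Qed.

Lemma is_chart_line_atlas (R : realType) :
  @line_atlas R `<=` @is_chart R 1 R.
Proof.
move=> _ ->; have imE : (fun r : R => const_mx r : 'rV_1) @` setT = setT.
  apply/seteqP; split=> // w _; exists (w ord0 ord0) => //=.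
  by apply/rowP => j; rewrite mxE (ord1 j).
split=> /=.
- exact: openT.
- by rewrite imE; exact: openT.
- by move=> r _; rewrite mxE.
- apply: continuous_subspaceT => r; apply: cvg_rV => j.
  by under eq_fun do rewrite mxE; rewrite mxE; exact: cvg_id.
- apply: continuous_subspaceT; exact: coord_continuous.
Qed.

Lemma Ck_on_continuous (R : realType) (n p k : nat) (A : set 'rV[R]_n)
    (g : 'rV[R]_n -> 'rV[R]_p) (x : 'rV[R]_n) :
  Ck_on k A g -> A x -> {for x, continuous g}.
Proof.
case: k => [|k] /=; first by move=> + Ax; apply.
by move=> [+ _] Ax => /(_ _ Ax); exact: differentiable_continuous.
Qed.

(** Near a point of [S], the local extension [g] factors as a chart, its coordinate expression, and
    an inverse chart, each continuous at the relevant point. Continuity then passes from [g] to [f]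
    along the trace of the neighbourhood filter on [S], where the two maps agree. *)
Lemma Ck_map_continuous (R : realType) (n p k : nat) (T T' : topologicalType)
    (A : set (chart R n T)) (A' : set (chart R p T')) (S : set T)
    (f : T -> T') :
  A `<=` @is_chart R n T -> A' `<=` @is_chart R p T' ->
  Ck_map k A A' S f -> {within S, continuous f}.
Proof.
move=> hA hA' hf; apply/subspace_continuousP => z Sz.
have [c [c' [W [g [[/hA hc /hA' hc' oW Wz Wc] [gc' gf gC]]]]]] := hf z Sz.
have [_ _ cK _ _] := hc; have [_ _ cK' _ _] := hc'.
have nW : \forall y \near z, W y by exact: open_nbhs_nbhs.
have gz : g @ z --> g z.
  pose h := cmap c' \o g \o cinv c.
  have hz : (h \o cmap c) y @[y --> z] --> h (cmap c z).
    have ch : {for cmap c z, continuous h}.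
      by apply: (Ck_on_continuous gC); exists z.
    exact: cvg_comp (cmap_continuous hc (Wc _ Wz)) ch.
  have hE y : W y -> cinv c' (h (cmap c y)) = g y.
    by move=> Wy; rewrite /h /= cK ?cK'; auto.
  (* The inverse chart is controlled only on the image of [cdom c'], so the base point has to be
     placed there. *)
  have hi : (cmap c' @` cdom c') (h (cmap c z)).
    by exists (g z); rewrite /h /= ?cK; auto.
  have gE : {near z, cinv c' \o (h \o cmap c) =1 g}.
    by apply: filterS nW => y Wy /=; rewrite hE.
  rewrite -(hE z Wz); apply: cvg_trans (near_eq_cvg gE) _.
  exact: cvg_comp hz (cinv_continuous hc' hi).
rewrite /from_subspace -(gf z)//.
have gSz : g @ within S (nbhs z) --> g z by exact: cvg_within_filter gz.
have gf' : {near within S (nbhs z), g =1 f}.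
  by rewrite near_withinE; apply: filterS nW => y Wy Sy; rewrite gf.
exact: cvg_trans (near_eq_cvg gf') gSz.
Qed.

(** * Dependence of predictions and cost on the input sequence, and existence of minimizers *)

Lemma within_continuous_comp_sub (T1 T2 T3 : topologicalType) (A : set T1)
    (B : set T2) (g : T1 -> T2) (h : T2 -> T3) :
  {within A, continuous g} -> {within B, continuous h} ->
  (forall x, A x -> B (g x)) -> {within A, continuous (h \o g)}.
Proof.
move=> /subspace_continuousP gA /subspace_continuousP hB AB.
apply/subspace_continuousP => x Ax Q /(hB _ (AB x Ax)) /(gA x Ax).
rewrite /nbhs /= /within /= /nbhs /=.
by apply: filterS => y + Ay => /(_ Ay); apply; exact: AB.
Qed.

Lemma within_continuous_pair (T1 T2 T3 : topologicalType) (A : set T1)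
    (g : T1 -> T2) (h : T1 -> T3) :
  {within A, continuous g} -> {within A, continuous h} ->
  {within A, continuous (fun x => (g x, h x))}.
Proof.
move=> /subspace_continuousP gA /subspace_continuousP hA.
apply/subspace_continuousP => x Ax.
exact: cvg_pair (gA x Ax) (hA x Ax).
Qed.

Lemma eq_predicted (M P : Type) (f : M * P -> M) (x : M) (v w : nat -> P) i :
  (forall j, (j < i)%N -> v j = w j) ->
  predicted f x v i = predicted f x w i.
Proof.
elim: i => //= i IH vw; rewrite vw// IH// => j ji.
by apply: vw; exact: ltnW.
Qed.

(** [predicted] recurses on the last step; peeling off the first step instead is what a receding
    horizon requires. *)
Lemma predicted_shift (M P : Type) (f : M * P -> M) (x : M) (v : nat -> P) i :
  predicted f x v i.+1 = predicted f (f (x, v 0%N)) (fun j => v j.+1) i.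
Proof. by elim: i => //= i <-. Qed.

(** This turns state feedback into an open-loop input sequence, the form in which admissibility and
    cost are expressed. *)
Lemma predicted_feedback (M P : Type) (f : M * P -> M) (kappa : M -> P) (x : M) i :
  predicted f x (fun j => kappa (iter j (fun y => f (y, kappa y)) x)) i =
  iter i (fun y => f (y, kappa y)) x.
Proof. by elim: i => //= i ->. Qed.

(** By induction on [i]: coordinate projections are continuous for the product topology, and inputs
    in [Uc] keep every pair in the set where [f] is continuous. *)
Lemma predicted_continuous (M P : topologicalType) (f : M * P -> M)
    (Uc : set P) (x : M) (i : nat) :
  {within setT `*` Uc, continuous f} ->
  {within [set v : prod_topology (fun _ : nat => P) | forall j, Uc (v j)],
    continuous (fun v => predicted f x v i)}.
Proof.
move=> fc; elim: i => [|i IH] /=.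
  by apply: continuous_subspaceT; exact: cst_continuous.
apply: (within_continuous_comp_sub _ fc) => [|v Kv]; last by split=> /=.
apply: within_continuous_pair => //; apply: continuous_subspaceT.
exact: (@proj_continuous _ (fun _ : nat => P) i).
Qed.

Lemma ocp_cost_continuous (R : realType) (M P : topologicalType)
    (f : M * P -> M) (L : M * P -> R) (F : M -> R) (Uc : set P) (N : nat)
    (x : M) :
  {within setT `*` Uc, continuous f} -> {within setT `*` Uc, continuous L} ->
  continuous F ->
  {within [set v : prod_topology (fun _ : nat => P) | forall j, Uc (v j)],
    continuous (fun v => ocp_cost f L F N x v)}.
Proof.
move=> fc Lc Fc; apply/subspace_continuousP => v Kv.
have Fv : {within [set v : prod_topology (fun _ : nat => P) |
    forall j, Uc (v j)], continuous (fun v => F (predicted f x v N))}.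
  apply: (@within_continuous_comp_sub _ _ _ _ setT _ F) => //.
    exact: predicted_continuous.
  exact: continuous_subspaceT.
have Lv i : {within [set v : prod_topology (fun _ : nat => P) |
    forall j, Uc (v j)], continuous (fun v => L (predicted f x v i, v i))}.
  apply: (within_continuous_comp_sub _ Lc) => [|w Kw]; last by split=> /=.
  apply: within_continuous_pair; first exact: predicted_continuous.
  apply: continuous_subspaceT.
  exact: (@proj_continuous _ (fun _ : nat => P) i).
apply: cvgD; first by have /subspace_continuousP := Fv; apply.
apply: cvg_big => [|i _]; first exact: add_continuous.
by have /subspace_continuousP := Lv i; apply.
Qed.

(** The extreme value theorem applies on [K] intersected with [B]: [K] is compact by Tychonoff, and
    [B] collects the state constraints, which are closed conditions relative to [K]. *)
Lemma ocp_minimizer_exists (R : realType) (M P : topologicalType)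
    (f : M * P -> M) (L : M * P -> R) (F : M -> R) (X : set M) (Uc : set P)
    (XT : set M) (N : nat) (x : M) :
  (0 < N)%N -> closed X -> closed XT -> compact Uc ->
  {within setT `*` Uc, continuous f} -> {within setT `*` Uc, continuous L} ->
  continuous F -> feasible_set f X Uc XT N x ->
  exists v, ocp_minimizer f L F X Uc XT N x v.
Proof.
move=> N0 cX cXT cU fc Lc Fc [v0 v0A].
pose K := [set v : prod_topology (fun _ : nat => P) | forall j, Uc (v j)].
pose B := [set v : prod_topology (fun _ : nat => P) |
  (forall i, (i < N)%N -> X (predicted f x v i)) /\ XT (predicted f x v N)].
have cK : compact K.
  exact: (@tychonoff nat (fun _ => P) (fun _ => Uc) (fun _ => cU)).
(* Closedness is taken in the subspace [K], because the predictions are known to be continuous only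
   there. *)
have pc i (C : set M) : closed C ->
    closed ((fun v => predicted f x v i) @^-1` C : set (subspace K)).
  move=> cC; have pi : {within K, continuous (fun v => predicted f x v i)}.
    exact: predicted_continuous.
  exact: (continuous_closedP _).1 pi C cC.
have cB : closed (B : set (subspace K)).
  rewrite (_ : B = (\bigcap_(i in [set i | (i < N)%N])
      ((fun v => predicted f x v i) @^-1` X)) `&`
      ((fun v => predicted f x v N) @^-1` XT)) //.
  by apply: closedI; [apply: closed_bigI => i _|]; exact: pc.
have cKB : compact (K `&` B).
  (* A relatively closed set is the trace on [K] of a closed set [V], so its intersection with [K]
     is compact. *)
  have [V cV VB] := (closed_subspaceP K B).1 cB.
  by rewrite setIC -VB setIC; exact: compact_closedI.
(* Inputs beyond the horizon are unconstrained, so a sequence has to be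
   modified there to fall in the compact set [K]. *)
pose trunc v : nat -> P := fun i => if (i < N)%N then v i else v 0%N.
have truncE v i : (i <= N)%N -> predicted f x (trunc v) i = predicted f x v i.
  move=> iN; apply: eq_predicted => j ji.
  by rewrite /trunc (leq_trans ji).
have truncKB v : ocp_admissible f X Uc XT N x v -> (K `&` B) (trunc v).
  move=> [vXU vXT]; split; last first.
    split; last by rewrite truncE.
    by move=> i iN; rewrite truncE ?(ltnW iN)//; have [] := vXU i iN.
  move=> j; rewrite /trunc; case: ifPn => jN.
    by have [] := vXU j jN.
  (* The padding value [v 0] lies in [Uc] because the horizon is positive. *)
  by have [] := vXU 0%N N0.
have trunc_cost v : ocp_cost f L F N x (trunc v) = ocp_cost f L F N x v.
  rewrite /ocp_cost truncE//; congr (_ + _); apply: eq_bigr => i _.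
  by rewrite truncE 1?ltnW// /trunc ltn_ord.
have costc : {within K `&` B,
    continuous (fun v : prod_topology (fun _ : nat => P) =>
      ocp_cost f L F N x v)}.
  apply: (@continuous_subspaceW _ _ _ K); first exact: subIsetl.
  exact: ocp_cost_continuous.
have KB0 : K `&` B !=set0 by exists (trunc v0); exact: truncKB.
have [v vKB vmin] := compact_EVT_min KB0 cKB costc.
exists v; move: vKB; rewrite inE => -[vK [vX vXT]]; split.
  by split=> // i iN; split; [exact: vX|exact: vK].
move=> w /truncKB wKB; rewrite -(trunc_cost w).
by apply: vmin; rewrite inE.
Qed.

(** * Admissible sequences built from the local control law *)

Lemma ocp_feedback (R : realType) (M P : Type) (f : M * P -> M)
    (L : M * P -> R) (F : M -> R) (X : set M) (Uc : set P) (XT : set M)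
    (kappa : M -> P) (N : nat) (x : M) :
  XT `<=` X ->
  (forall y, XT y -> [/\ Uc (kappa y), XT (f (y, kappa y)) &
    F (f (y, kappa y)) - F y <= - L (y, kappa y)]) ->
  XT x -> exists2 v, ocp_admissible f X Uc XT N x v &
    ocp_cost f L F N x v <= F x.
Proof.
move=> XTX kXT xXT; set g := fun y => f (y, kappa y).
have gXT i : XT (iter i g x) by elim: i => //= i IH; have [] := kXT _ IH.
exists (fun j => kappa (iter j g x)).
  split=> [i _|]; rewrite predicted_feedback//; split; first exact/XTX/gXT.
  by have [] := kXT _ (gXT i).
(* Induction on the horizon: at horizon 0 the cost is [F x], and each further feedback step adds a
   stage cost that the decrease of [F] compensates. *)
rewrite /ocp_cost; elim: N => [|N IH]; first by rewrite big_ord0 addr0.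
apply: le_trans IH; rewrite big_ord_recr /= !predicted_feedback.
have [_ _] := kXT _ (gXT N); rewrite lerBlDr -/g /= => gle.
by rewrite addrCA addrC lerD2r// -lerBrDr (le_trans gle)// addrC.
Qed.

(** The witness drops the first input of [v] and appends the local control at the terminal state
    [z]. The appended stage cost is absorbed by the decrease of [F] at [z], so the net saving is at
    least the dropped stage cost. *)
Lemma ocp_successor (R : realType) (M P : Type) (f : M * P -> M)
    (L : M * P -> R) (F : M -> R) (X : set M) (Uc : set P) (XT : set M)
    (kappa : M -> P) (N : nat) (x : M) (v : nat -> P) :
  (0 < N)%N -> XT `<=` X ->
  (forall y, XT y -> [/\ Uc (kappa y), XT (f (y, kappa y)) &
    F (f (y, kappa y)) - F y <= - L (y, kappa y)]) ->
  ocp_admissible f X Uc XT N x v ->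
  exists2 w, ocp_admissible f X Uc XT N (f (x, v 0%N)) w &
    ocp_cost f L F N (f (x, v 0%N)) w <= ocp_cost f L F N x v - L (x, v 0%N).
Proof.
(* From here the horizon is [N.+1], so the appended input has index [N]. *)
case: N => // N _ XTX kXT [vXU vXT].
set z := predicted f x v N.+1 in vXT.
have [kU kT kF] := kXT z vXT.
pose w i := if (i < N)%N then v i.+1 else kappa z.
have wE i : (i <= N)%N -> predicted f (f (x, v 0%N)) w i = predicted f x v i.+1.
  move=> iN; rewrite predicted_shift; apply: eq_predicted => j ji.
  by rewrite /w (leq_trans ji).
have wN : w N = kappa z by rewrite /w ltnn.
have wSN : predicted f (f (x, v 0%N)) w N.+1 = f (z, kappa z).
  by rewrite [LHS]/= wE// wN.
exists w.
  split=> [i|]; last by rewrite wSN.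
  rewrite ltnS => iN; rewrite wE//; move: iN; rewrite leq_eqVlt.
  case/orP => [/eqP ->|iN]; first by rewrite wN; split=> //; exact: XTX.
  by rewrite /w iN; exact: vXU.
(* Splitting off the last stage on the left and the first on the right leaves equal middle sums;
   what remains is the inequality [kF] at [z]. *)
rewrite /ocp_cost wSN big_ord_recr big_ord_recl /= wE// wN -/z.
have -> : \sum_(i < N) L (predicted f (f (x, v 0%N)) w i, w i) =
    \sum_(i < N) L (predicted f x v (bump 0 i), v (bump 0 i)).
  by apply: eq_bigr => i _; rewrite wE 1?ltnW// /w ltn_ord.
set S := \sum_(i < N) _; rewrite [in leRHS]addrAC -[leRHS]addrA.
move: kF; rewrite -/z => kF; lra.
Qed.

(** * Comparison bounds and decay of the optimal cost along the closed loop *)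

Lemma stage_cost_le_ocp_cost (R : realType) (M P : Type) (f : M * P -> M)
    (L : M * P -> R) (F : M -> R) (X : set M) (Uc : set P) (XT : set M)
    (N : nat) (x : M) (v : nat -> P) :
  (0 < N)%N -> (forall y w, Uc w -> 0 <= L (y, w)) -> (forall y, 0 <= F y) ->
  ocp_admissible f X Uc XT N x v -> L (x, v 0%N) <= ocp_cost f L F N x v.
Proof.
case: N => // N _ L0 F0 [vXU _].
rewrite /ocp_cost big_ord_recl /= addrCA lerDl addr_ge0// sumr_ge0// => i _.
by apply: L0; have [] := vXU (lift ord0 i) (ltn_ord _).
Qed.

(** Used to turn bounds on [gamma] of a distance into bounds on the distance without an inverse of
    [gamma]. *)
Lemma class_K_lt (R : realType) (gamma : R -> R) (r s : R) :
  class_K +oo%E gamma -> 0 <= r -> 0 <= s -> gamma r < gamma s -> r < s.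
Proof.
move=> [_ _ _ gmono] r0 s0; apply: contraTT; rewrite -!leNgt le_eqVlt.
case/orP => [/eqP ->//|sr]; apply: ltW.
by apply: gmono => //; rewrite ltry.
Qed.

(** A nonincreasing sequence bounded below converges, and its shift has the same limit. *)
Lemma decreasing_gap_cvg (R : realType) (V : nat -> R) :
  (forall k, 0 <= V k) -> (forall k, V k.+1 <= V k) ->
  (V k - V k.+1) @[k --> \oo] --> (0 : R).
Proof.
move=> V0 Vdec.
have cV : cvgn V.
  apply: nonincreasing_is_cvgn; first exact/nonincreasing_seqP.
  by exists 0 => _ [k _ <-].
rewrite -(subrr (limn V)); apply: cvgB => //.
by move: cV; rewrite -(cvg_shiftS V).
Qed.

Lemma closed_loop_value (R : realType) (M P : topologicalType)
    (U : set P) (f : M * P -> M) (L : M * P -> R) (F : M -> R) (X : set M)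
    (Uc : set P) (XT : set M) (kappa : M -> P) (N : nat) (x : nat -> M) :
  (0 < N)%N ->
  (forall y, feasible_set f X Uc XT N y ->
    exists v, ocp_minimizer f L F X Uc XT N y v) ->
  XT `<=` X ->
  (forall y, XT y -> [/\ Uc (kappa y), XT (f (y, kappa y)) &
    F (f (y, kappa y)) - F y <= - L (y, kappa y)]) ->
  closed_loop U f L F X Uc XT N x -> feasible_set f X Uc XT N (x 0%N) ->
  exists v : nat -> nat -> P, forall k,
    ocp_minimizer f L F X Uc XT N (x k) (v k) /\
    ocp_cost f L F N (x k.+1) (v k.+1) <=
      ocp_cost f L F N (x k) (v k) - L (x k, v k 0%N).
Proof.
move=> N0 min_ex XTX kXT [u xu] x0F.
have step k v : ocp_minimizer f L F X Uc XT N (x k) v -> u k = v 0%N ->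
    exists2 w, ocp_admissible f X Uc XT N (x k.+1) w &
      ocp_cost f L F N (x k.+1) w <=
        ocp_cost f L F N (x k) v - L (x k, v 0%N).
  move=> [vA _] uv; have [_ -> _] := xu k; rewrite uv.
  exact: ocp_successor N0 XTX kXT vA.
(* Feasibility travels with the induction: [step] makes the next state feasible, [min_ex] then gives
   a minimizer there, and only then does [closed_loop] tie the next input to some minimizer. *)
have vk k : exists v, ocp_minimizer f L F X Uc XT N (x k) v /\ u k = v 0%N.
  elim: k => [|k [v [vm uv]]].
    by have [_ _ /(_ (min_ex _ x0F)) [v ? ?]] := xu 0%N; exists v.
  have [w wA _] := step _ _ vm uv.
  have [] := xu k.+1; move=> _ _ [|v' ? ?]; last by exists v'.
  by apply: min_ex; exists w.
have [v vP] := choice vk; exists v => k; have [vm uv] := vP k.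
split=> //; have [w wA wcost] := step _ _ vm uv.
by apply: le_trans wcost; have [[_ vmin] _] := vP k.+1; exact: vmin.
Qed.

(** * Recursive feasibility and asymptotic stability *)

Theorem theorem1 (R : realType) (n m N : nat)
    (M : metricType R) (AM : set (chart R n M))
    (P : topologicalType) (AP : set (chart R m P)) (U : set P)
    (f : M * P -> M) (xe : M) (ue : P) (X : set M) (Uc : set P)
    (L : M * P -> R) (F : M -> R) (gamma alpha : R -> R) (a : \bar R)
    (XT : set M) (kappa : M -> P)
    (N_gt0 : (0 < N)%N)
    (M_manifold : smooth_manifold AM)
    (P_manifold : smooth_manifold AP)
    (U_compact : compact U)
    (f_C1 : Ck_map 1 (prod_atlas AM AP) AM (setT `*` U) f)
    (U_ue : U ue)
    (f_eq : f (xe, ue) = xe)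
    (X_compact : compact X) (X_connected : connected X)
    (Uc_sub : Uc `<=` U) (Uc_compact : compact Uc) (Uc_connected : connected Uc)
    (X_int : X° xe)
    (Uc_int : within U (nbhs ue) Uc)
    (L_C2 : Ck_map 2 (prod_atlas AM AP) (@line_atlas R) (setT `*` U) L)
    (F_C2 : Ck_map 2 AM (@line_atlas R) setT F)
    (L_eq0 : L (xe, ue) = 0) (F_eq0 : F xe = 0)
    (gamma_Kinfty : class_Kinfty gamma)
    (alpha_K : class_K a alpha)
    (L_ge : forall x u, U u ->
      L (x, ue) <= L (x, u) /\ gamma (mdist x xe) <= L (x, ue))
    (F_ge : forall x, ((mdist x xe)%:E < a)%E /\ alpha (mdist x xe) <= F x)
    (XT_sub : XT `<=` X) (XT_compact : compact XT) (XT_int : XT° xe)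
    (kappa_U : forall x, U (kappa x))
    (kappa_XT : forall x, XT x ->
      [/\ Uc (kappa x), XT (f (x, kappa x)) &
          F (f (x, kappa x)) - F x <= - L (x, kappa x)]) :
  (forall x : nat -> M, closed_loop U f L F X Uc XT N x ->
     feasible_set f X Uc XT N (x 0%N) ->
     forall k, feasible_set f X Uc XT N (x k)) /\
  asymptotically_stable (closed_loop U f L F X Uc XT N) xe
    (feasible_set f X Uc XT N).
Proof.
have hM : AM `<=` @is_chart R n M by have [_ _ hM _ _] := M_manifold.
have hP : AP `<=` @is_chart R m P by have [_ _ hP _ _] := P_manifold.
have hMP := is_chart_prod_atlas hM hP.
have sub : [set: M] `*` Uc `<=` setT `*` U.
  by move=> [y w] [/= _ wUc]; split=> //; exact: Uc_sub.
have fc : {within setT `*` Uc, continuous f}.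
  exact: continuous_subspaceW sub (Ck_map_continuous hMP hM f_C1).
have Lc : {within setT `*` Uc, continuous L}.
  apply: continuous_subspaceW sub _.
  exact: Ck_map_continuous hMP (@is_chart_line_atlas R) L_C2.
have Fc : continuous F.
  have := Ck_map_continuous hM (@is_chart_line_atlas R) F_C2.
  rewrite continuous_open_subspace; last exact: openT.
  by move=> Fc y; apply: Fc; rewrite inE.
have cX : closed X := compact_closed (@metric_hausdorff R M) X_compact.
have cXT : closed XT := compact_closed (@metric_hausdorff R M) XT_compact.
have min_ex y := @ocp_minimizer_exists _ _ _ f L F X Uc XT N y N_gt0 cX cXT
  Uc_compact fc Lc Fc.
have gK := gamma_Kinfty.1; have [_ g0 gge0 gmono] := gK.
have [_ _ alpha_ge0 _] := alpha_K.
have g_ge0 y : 0 <= gamma (mdist y xe).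
  by apply: gge0; [exact: mdist_ge0|rewrite ltry].
have L_gamma y w : U w -> gamma (mdist y xe) <= L (y, w).
  by move=> /(L_ge y) [Lue gL]; exact: le_trans gL Lue.
have F0 y : 0 <= F y.
  have [ya aF] := F_ge y; apply: le_trans aF.
  by apply: alpha_ge0 => //; exact: mdist_ge0.
have cost_gamma y v : ocp_admissible f X Uc XT N y v ->
    gamma (mdist y xe) <= L (y, v 0%N) /\ L (y, v 0%N) <= ocp_cost f L F N y v.
  move=> vA; have [vU _] := vA; split.
    by apply/L_gamma/Uc_sub; have [] := vU 0%N N_gt0.
  apply: stage_cost_le_ocp_cost vA => // y' w /Uc_sub wU.
  exact: le_trans (g_ge0 _) (L_gamma y' _ wU).
have XTxe : XT xe by exact: interior_subset XT_int.
(* [V] is the optimal cost along the trajectory and serves as a Lyapunov function. Its bound by [F]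
   at time 0 compares the minimizer with the pure feedback sequence. *)
have value x (xcl : closed_loop U f L F X Uc XT N x)
    (x0 : feasible_set f X Uc XT N (x 0%N)) :
    exists V : nat -> R, [/\ forall k, feasible_set f X Uc XT N (x k),
      forall k, gamma (mdist (x k) xe) <= V k,
      forall k, V k.+1 <= V k - gamma (mdist (x k) xe) &
      XT (x 0%N) -> V 0%N <= F (x 0%N)].
  have [v vP] := closed_loop_value N_gt0 min_ex XT_sub kappa_XT xcl x0.
  exists (fun k => ocp_cost f L F N (x k) (v k)); split=> [k|k|k|x0XT].
  - by exists (v k); have [[]] := vP k.
  - by have [[/cost_gamma [gL Lc'] _] _] := vP k; exact: le_trans Lc'.
  - have [[/cost_gamma [gL _] _] /le_trans] := vP k; apply.
    by rewrite lerB.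
  - have [w wA] := ocp_feedback N XT_sub kappa_XT x0XT.
    by apply: le_trans; have [[_ vmin] _] := vP 0%N; exact: vmin.
have V_le (V g : nat -> R) : (forall k, 0 <= g k) ->
    (forall k, V k.+1 <= V k - g k) -> forall k, V k.+1 <= V k.
  by move=> gp Vg k; apply: le_trans (Vg k) _; rewrite gerBl.
have stable x (xcl : closed_loop U f L F X Uc XT N x) : XT (x 0%N) ->
    forall k, gamma (mdist (x k) xe) <= F (x 0%N).
  move=> x0XT k.
  have [v vA _] := ocp_feedback N XT_sub kappa_XT x0XT.
  have [|V [_ gV Vdec V0]] := value x xcl; first by exists v.
  apply: le_trans (gV k) (le_trans _ (V0 x0XT)).
  by elim: k => // k; apply: le_trans; apply: V_le Vdec k.
split=> [x xcl /(value x xcl) [V []]//|].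
split.
(* Starting at [xe], [stable] bounds [gamma] of every distance by [F xe], which is 0; a positive
   distance would contradict strict monotonicity. *)
- move=> x xcl x0 k; apply: mdist_positivity; apply/eqP.
  rewrite eq_le mdist_ge0 andbT leNgt; apply/negP => d0.
  have := stable x xcl; rewrite x0 F_eq0 => /(_ XTxe k); apply/negP.
  by rewrite -ltNge -g0; apply: gmono => //; rewrite ltry.
- move=> eps eps0.
  have geps : 0 < gamma eps by rewrite -g0; apply: gmono => //; rewrite ltry.
  (* [delta] is the radius of a ball around [xe] inside [XT] on which [F] stays below [gamma eps];
     it depends on [eps] alone, not on the trajectory. *)
  have : \forall y \near xe, XT y /\ F y < gamma eps.
    apply: filterI; first exact: XT_int.
    by apply: (cvgr_lt (F xe) (Fc xe)); rewrite F_eq0.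
  move=> /nbhs_ballP [delta /= delta0 ball_sub]; exists delta => // x xcl _ dx k _.
  have [|x0XT Fx0] := ball_sub (x 0%N).
    by rewrite ballEmdist /= metric_sym.
  apply: (class_K_lt gK) => //; [exact: mdist_ge0|exact: ltW|].
  exact: le_lt_trans (stable x xcl x0XT k) Fx0.
- move=> x xcl /(value x xcl) [V [_ gV Vdec _]].
  have V0 k : 0 <= V k by exact: le_trans (gV k).
  have gap := decreasing_gap_cvg V0 (V_le V _ (fun k => g_ge0 (x k)) Vdec).
  apply/cvgr0Pnorm_lt => eps eps0.
  have geps : 0 < gamma eps by rewrite -g0; apply: gmono => //; rewrite ltry.
  near=> k.
  (* The decrement of [V] at [k] dominates [gamma] of the distance, so once it is below [gamma eps]
     the distance is below [eps]. *)
  have Vk : V k - V k.+1 < gamma eps by near: k; exact: (cvgr_lt 0 gap).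
  rewrite ger0_norm ?mdist_ge0//.
  apply: (class_K_lt gK); [exact: mdist_ge0|exact: ltW|].
  by apply: le_lt_trans Vk; rewrite lerBrDr addrC -lerBrDr.
Unshelve. all: end_near. Qed.
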